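(* Assume (C1)–(C6) of the context, and that $\tilde I_i\equiv0$ for each $i\in I=\{1,\dots,m\}$. Let $K=\{(\omega,x(\omega)):\omega\in\Omega\}$ be a minimal subset of $\Omega\times BU$ with $K\subset\Omega\times BU_D^+$. Let $J_1,\dots,J_k$ be all the irreducible subsets of $I$ and $J_0=I\setminus\bigcup_{l=1}^kJ_l$. Then: (i) There exists $c\ge0$ such that $M|_K\equiv c$, where $M$ is the total mass. (ii) $x_i\equiv0$ for each $i\in J_0$. (iii) If, for some $l\in\{1,\dots,k\}$, there exists $j_l\in J_l$ such that $x_{j_l}\equiv0$, then $x_i\equiv0$ for each $i\in J_l$. In particular, this happens if there is a $j_l\in J_l$ such that there is outflow of material from $C_{j_l}$. (Here $x_i\equiv0$ means that the $i$-th component of $x(\omega)$ vanishes identically on $(-\infty,0]$ for every $\omega\in\Omega$.)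
   Context: Notation. $X=C((-\infty,0],\mathbb{R}^m)$ carries the compact-open topology. $BU\subset X$ is the Banach space of bounded uniformly continuous functions with the supremum norm $\|x\|_\infty$; $B_r=\{x\in BU:\|x\|_\infty\le r\}$. For continuous $x$ on $(-\infty,a]$ and $t\le a$, $x_t(s)=x(t+s)$, $s\le0$. $\mathbb{R}^+=[0,\infty)$. Compartmental system (compartments $C_1,\dots,C_m$, environment $C_0$, pipe $P_{ij}$ from $C_j$ to $C_i$). For $i\in\{0,\dots,m\}$, $j\in\{1,\dots,m\}$ let $\tilde g_{ij}\colon\mathbb{R}\times\mathbb{R}\to\mathbb{R}$, and for $i\in\{1,\dots,m\}$ let $\tilde I_i\colon\mathbb{R}\to[0,\infty)$; put $\tilde g_{i0}(t,v)=\tilde I_i(t)$ and $\tilde g=(\tilde g_{ij})\colon\mathbb{R}\times\mathbb{R}\to\mathbb{R}^{m(m+2)}$. For $i,j\in\{1,\dots,m\}$ let $\mu_{ij},\nu_{ij}$ be positive regular Borel measures on $(-\infty,0]$ with finite total variation. The system is, for $i=1,\dots,m$, $$\tfrac{d}{dt}\Big[z_i(t)-\sum_{j=1}^m\int_{-\infty}^0z_j(t+s)\,d\nu_{ij}(s)\Big]=-\tilde g_{0i}(t,z_i(t))-\sum_{j=1}^m\tilde g_{ji}(t,z_i(t))+\sum_{j=1}^m\int_{-\infty}^0\tilde g_{ij}(t+s,z_j(t+s))\,d\mu_{ij}(s)+\tilde I_i(t).$$ Hypotheses: (C1) $\tilde g$ is $C^1$-admissible, i.e. $C^1$ in its second variable,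 with $\tilde g$ and $\frac{\partial\tilde g}{\partial v}$ uniformly continuous and bounded on $\mathbb{R}\times\{v_0\}$ for all $v_0\in\mathbb{R}$; all components are monotone (nondecreasing) in the second variable; and $\tilde g_{ij}(t,0)=0$ for all $t\in\mathbb{R}$, $i\in\{0,\dots,m\}$, $j\in\{1,\dots,m\}$. (C2) $\tilde g$ is recurrent, i.e. its hull is minimal. (C3) $\mu_{ij}(-\infty,0]=1$ and $\int_{-\infty}^0|s|\,d\mu_{ij}(s)<\infty$. (C4) $\nu_{ij}(\{0\})=0$ and $\sum_{j=1}^m\nu_{ij}(-\infty,0]<1$ for each $i$. Define $D\colon BU\to\mathbb{R}^m$ by $D_ix=x_i(0)-\sum_{j=1}^m\int_{-\infty}^0x_j(s)\,d\nu_{ij}(s)$. (C5) The measures $d\eta_{ij}=c_{ij}\,d\mu_{ij}-\sum_{k=0}^md_{ki}\,d\nu_{ij}$ ($1\le i,j\le m$) are positive, where $c_{ij}=\inf_{(t,v)\in\mathbb{R}^2}\frac{\partial\tilde g_{ij}}{\partial v}(t,v)$, $d_{ij}=\sup_{(t,v)\in\mathbb{R}^2}\frac{\partial\tilde g_{ij}}{\partial v}(t,v)$. (C6) Given $i\in\{0,\dots,m\}$ and $j\in\{1,\dots,m\}$, either $\tilde g_{ij}\equiv0$ on $\mathbb{R}\times\mathbb{R}^+$ (there is no pipe from $C_j$ to $C_i$), or for each $v>0$ there is a $\delta_v>0$ such that $\tilde g_{ij}(t,v)\ge\delta_v$ for all $t\in\mathbb{R}$; in the latter case the pipe $P_{ij}$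 is said to carry material. There is outflow of material from $C_j$ if $P_{0j}$ carries material. Irreducible sets. For $J\subset I$ let $\zeta(J)=\bigcup_{j\in J}\{i\in I:P_{ij}\text{ carries material}\}$. A nonempty $J\subset I$ is irreducible if $\zeta(J)\subset J$ and no nonempty proper subset of $J$ has that property. Family over the hull. $\Omega$ is the hull of $\tilde g$: the closure of $\{\tilde g_t:t\in\mathbb{R}\}$, $\tilde g_t(s,v)=\tilde g(t+s,v)$, in the topology of uniform convergence on compact sets; it is a compact metric space with the translation flow $(\omega\cdot t)(s,v)=\omega(t+s,v)$, minimal by (C2). Put $g(\omega,v)=\omega(0,v)$, $g=(g_{ij})$, $I_i(\omega)=g_{i0}(\omega,\cdot)$, and $F_i(\omega,x)=-g_{0i}(\omega,x_i(0))-\sum_{j=1}^mg_{ji}(\omega,x_i(0))+\sum_{j=1}^m\int_{-\infty}^0g_{ij}(\omega\cdot s,x_j(s))\,d\mu_{ij}(s)+I_i(\omega)$ for $(\omega,x)\in\Omega\times BU$. The family is $\frac{d}{dt}Dz_t=F(\omega\cdot t,z_t)$, $t\ge0$, $\omega\in\Omega$; $z(t,\omega,x)$ is the unique solution with initial value $x\in BU$, $u(t,\omega,x)(s)=z(t+s,\omega,x)$, and $\tau(t,\omega,x)=(\omega\cdot t,u(t,\omega,x))$ is the induced skew-product semiflow. It is part of the setting that $F$ is continuous and locally Lipschitz in $x$ for $\|\cdot\|_\infty$, bounded on each $\Omega\times B_r$, and continuous on each $\Omega\times B_r$ for the compact-open topology on $B_r$. A minimal subset of $\Omega\times BU$ is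 a nonempty compact (for the product metric topology, compact-open on $BU$) positively $\tau$-invariant set containing no other nonempty compact positively invariant set; every such set is of the form $\{(\omega,x(\omega)):\omega\in\Omega\}$ with $x\colon\Omega\to BU$ continuous for the compact-open topology and $x(\omega\cdot t)=u(t,\omega,x(\omega))$. $BU_D^+=\{x\in BU:Dx_s\ge0\text{ for each }s\le0\}$. Total mass: $M(\omega,x)=\sum_{i=1}^mD_ix+\sum_{i=1}^m\sum_{j=1}^m\int_{-\infty}^0\Big(\int_s^0g_{ji}(\omega\cdot\tau,x_i(\tau))\,d\tau\Big)d\mu_{ji}(s)$. *)

(* Defs.v *)
From HB Require Import structures.
From mathcomp Require Import all_boot all_order all_algebra.
From mathcomp Require Import all_classical all_reals all_analysis.
Set Implicit Arguments.
Unset Strict Implicit.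
Unset Printing Implicit Defensive.
Import Order.TTheory GRing.Theory Num.Theory.
Import numFieldNormedType.Exports.
Local Open Scope classical_set_scope.
Local Open Scope ring_scope.

(* A minimal set for a notion of invariance: nonempty, compact and invariant,
   with no other nonempty compact invariant subset. *)
Definition minimal_set (T : topologicalType) (inv : set T -> Prop)
    (A : set T) : Prop :=
  [/\ A !=set0, compact A, inv A &
      forall B : set T, B `<=` A -> B !=set0 -> compact B -> inv B -> B = A].

Definition past (R : realType) : set R := [set` `]-oo, 0]].
Arguments past R _ : clear implicits.

(* Compartments C_1, ..., C_m are indexed by 'I_m. The nodes 0, ..., m
   (environment included) are indexed by 'I_m.+1: [ord0] is the environment
   and [lift ord0 i] is the compartment i. Thus [pipe S i j] is the transport
   function of the pipe from the compartment j to the node i.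
   The measures are Borel measures on the line of which only the restriction
   to ]-oo, 0] is ever used; finite Borel measures are automatically regular. *)
Record compartmental_system (R : realType) (m : nat) := CompartmentalSystem {
  pipe : 'I_m.+1 -> 'I_m -> R -> R -> R ;
  inflow : 'I_m -> R -> R ;
  inflow_ge0 : forall i t, 0 <= inflow i t ;
  mu : 'I_m -> 'I_m -> {finite_measure set (measurableTypeR R) -> \bar R} ;
  nu : 'I_m -> 'I_m -> {finite_measure set (measurableTypeR R) -> \bar R}
}.

(* The transport functions take values in R^(m(m+2)), arranged as the matrix of
   the g_ij, 0 <= i <= m, 1 <= j <= m, and the row of the g_i0, 1 <= i <= m. *)
Notation flux R m := (matrix R%type m.+1 m * matrix R%type 1 m)%type.

Notation transport R m := {family compact, (R%type * R%type)%type -> flux R m}.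

(* A history x on ]-oo, 0] is represented by its extension to the whole line
   that is constant on [0, +oo[. This embeds C(]-oo, 0], R^m) homeomorphically
   in C(R, R^m) for the compact-open topologies, and isometrically for the
   supremum norms, so no information is carried by the values at s > 0. *)
Notation history R m := {compact-open, R -> 'rV[R]_m}.

(* The same functions, with the topology of the supremum norm. *)
Notation unif_history R m := {uniform R -> 'rV[R]_m}.

Definition segment (R : realType) (m : nat) (z : R -> 'rV[R]_m) (t : R) :
    history R m :=
  fun s => z (t + Num.min s 0).

Definition BU (R : realType) (m : nat) : set (R -> 'rV[R]_m) :=
  [set x : R -> 'rV[R]_m |
    [/\ forall s : R, 0 <= s -> x s = x 0, bounded_fun x &
        unif_continuous (x : R -> 'rV[R]_m)]].

Definition supnorm (R : realType) (m : nat) (x : R -> 'rV[R]_m) : R :=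
  sup [set `|x s| | s in past R].

Definition BU_ball (R : realType) (m : nat) (r : R) : set (R -> 'rV[R]_m) :=
  [set x | BU x /\ supnorm x <= r].

Definition translate (R : realType) (m : nat) (t : R) (w : transport R m) :
    transport R m :=
  fun p => w (t + p.1, p.2).

Definition translation_invariant (R : realType) (m : nat)
    (W : set (transport R m)) : Prop :=
  forall t w, W w -> W (translate t w).

(* g_ij(w . t, v) and I_i(w . t); the inflow components of the elements of the
   hull do not depend on v, so they are read at v = 0. *)
Definition wpipe (R : realType) (m : nat) (w : transport R m)
    (i : 'I_m.+1) (j : 'I_m) (t v : R) : R := (w (t, v)).1 i j.

Definition winflow (R : realType) (m : nat) (w : transport R m)
    (i : 'I_m) (t : R) : R := (w (t, 0)).2 ord0 i.

Definition gtilde (R : realType) (m : nat) (S : compartmental_system R m) :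
    transport R m :=
  fun p => (\matrix_(i, j) pipe S i j p.1 p.2, \row_i inflow S i p.1).

Definition hull (R : realType) (m : nat) (S : compartmental_system R m) :
    set (transport R m) :=
  closure (range (fun t : R => translate t (gtilde S))).

Definition Dop (R : realType) (m : nat) (S : compartmental_system R m)
    (i : 'I_m) (x : R -> 'rV[R]_m) : R :=
  x 0 ord0 i - \sum_(j < m) \int[nu S i j]_(s in past R) (x s ord0 j).

Definition vector_field (R : realType) (m : nat) (S : compartmental_system R m)
    (i : 'I_m) (w : transport R m) (x : R -> 'rV[R]_m) : R :=
  - wpipe w ord0 i 0 (x 0 ord0 i)
  - \sum_(j < m) wpipe w (lift ord0 j) i 0 (x 0 ord0 i)
  + \sum_(j < m) \int[mu S i j]_(s in past R)
      (wpipe w (lift ord0 i) j s (x s ord0 j))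
  + winflow w i 0.

(* z : R -> R^m is a solution on the whole of [0, +oo[ of the equation of the
   family given by w, with initial history x; the derivative at 0 is the
   right one. *)
Definition is_solution (R : realType) (m : nat) (S : compartmental_system R m)
    (w : transport R m) (x : R -> 'rV[R]_m) (z : R -> 'rV[R]_m) : Prop :=
  [/\ continuous z, (forall s, s <= 0 -> z s = x s) &
      forall (i : 'I_m) (t : R), 0 <= t ->
        (Dop S i (segment z r) - Dop S i (segment z t)) / (r - t)
          @[r --> within `[0, +oo[ t^'] -->
        vector_field S i (translate t w) (segment z t)].

(* Positive invariance under the skew-product semiflow
   tau(t, w, x) = (w . t, u(t, w, x)). Solutions are unique when the field is
   locally Lipschitz, so this says that for (w, x) in P the solution
   z(., w, x) exists on [0, +oo[ and that tau(t, w, x) stays in P. *)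
Definition positively_invariant (R : realType) (m : nat)
    (S : compartmental_system R m)
    (P : set (transport R m * history R m)) : Prop :=
  forall w x, P (w, x) ->
    exists z, is_solution S w x z /\
      forall t, 0 <= t -> P (translate t w, segment z t).

Definition BUD_pos (R : realType) (m : nat) (S : compartmental_system R m) :
    set (R -> 'rV[R]_m) :=
  [set x | BU x /\ forall i s, s <= 0 -> 0 <= Dop S i (segment x s)].

Definition total_mass (R : realType) (m : nat) (S : compartmental_system R m)
    (w : transport R m) (x : R -> 'rV[R]_m) : R :=
  \sum_(i < m) Dop S i x +
  \sum_(i < m) \sum_(j < m) \int[mu S j i]_(s in past R)
    (\int[lebesgue_measure]_(r in `[s, 0])
       (wpipe w (lift ord0 j) i r (x r ord0 i))).

(* The standing properties of the vector field F of the family over the hull: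
   continuity and local Lipschitz continuity for the supremum norm, and
   boundedness and compact-open continuity on each ball. *)
Definition field_continuous (R : realType) (m : nat)
    (S : compartmental_system R m) : Prop :=
  forall i, {within [set p : transport R m * unif_history R m |
                      hull S p.1 /\ BU p.2],
             continuous (fun p => vector_field S i p.1 p.2)}.

Definition field_locally_lipschitz (R : realType) (m : nat)
    (S : compartmental_system R m) : Prop :=
  forall (w0 : transport R m) (x0 : unif_history R m), hull S w0 -> BU x0 ->
  exists U : set (transport R m * unif_history R m), nbhs (w0, x0) U /\
  exists L : R, forall i w x y, hull S w -> BU x -> BU y ->
    U (w, x) -> U (w, y) ->
    `|vector_field S i w x - vector_field S i w y| <=
      L * supnorm (fun s => x s - y s).

Definition field_bounded_on_balls (R : realType) (m : nat)
    (S : compartmental_system R m) : Prop :=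
  forall r : R, exists C : R, forall i w x, hull S w -> BU_ball r x ->
    `|vector_field S i w x| <= C.

Definition field_compact_open_continuous (R : realType) (m : nat)
    (S : compartmental_system R m) : Prop :=
  forall (r : R) i, {within [set p : transport R m * history R m |
                              hull S p.1 /\ BU_ball r p.2],
                     continuous (fun p => vector_field S i p.1 p.2)}.

Definition regular_field (R : realType) (m : nat)
    (S : compartmental_system R m) : Prop :=
  [/\ field_continuous S, field_locally_lipschitz S,
      field_bounded_on_balls S & field_compact_open_continuous S].

Definition C1_admissible (R : realType) (h : R -> R -> R) : Prop :=
  [/\ forall t v, derivable (h t) v 1,
      forall t, continuous (derive1 (h t)),
      forall v, unif_continuous (h ^~ v) /\ bounded_fun (h ^~ v) &
      forall v, unif_continuous (fun t => derive1 (h t) v) /\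
                bounded_fun (fun t => derive1 (h t) v)].

Definition condC1 (R : realType) (m : nat)
    (S : compartmental_system R m) : Prop :=
  [/\ forall i j, C1_admissible (pipe S i j),
      forall i, C1_admissible (fun t _ => inflow S i t),
      forall i j t, {homo pipe S i j t : v w / v <= w} &
      forall i j t, pipe S i j t 0 = 0].

Definition condC2 (R : realType) (m : nat)
    (S : compartmental_system R m) : Prop :=
  minimal_set (@translation_invariant R m) (hull S).

Definition condC3 (R : realType) (m : nat)
    (S : compartmental_system R m) : Prop :=
  forall i j, mu S i j (past R) = 1%E /\
    (\int[mu S i j]_(s in past R) `|s|%:E < +oo)%E.

Definition condC4 (R : realType) (m : nat)
    (S : compartmental_system R m) : Prop :=
  (forall i j, nu S i j [set 0] = 0%E) /\
  (forall i, (\sum_(j < m) nu S i j (past R) < 1)%E).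

Definition dpipe_inf (R : realType) (m : nat) (S : compartmental_system R m)
    (i : 'I_m.+1) (j : 'I_m) : \bar R :=
  ereal_inf (range (fun p : R * R => (derive1 (pipe S i j p.1) p.2)%:E)).

Definition dpipe_sup (R : realType) (m : nat) (S : compartmental_system R m)
    (i : 'I_m.+1) (j : 'I_m) : \bar R :=
  ereal_sup (range (fun p : R * R => (derive1 (pipe S i j p.1) p.2)%:E)).

(* The infimum is finite for pipes nondecreasing in v, so there is no
   +oo - +oo here; an infinite supremum is allowed on nu_ij-null sets only. *)
Definition eta_measure (R : realType) (m : nat) (S : compartmental_system R m)
    (i j : 'I_m) (A : set R) : \bar R :=
  (dpipe_inf S (lift ord0 i) j * mu S i j A
   - \sum_(k < m.+1) dpipe_sup S k i * nu S i j A)%E.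

Definition condC5 (R : realType) (m : nat)
    (S : compartmental_system R m) : Prop :=
  forall i j (A : set R), measurable A -> A `<=` past R ->
    (0 <= eta_measure S i j A)%E.

Definition carries (R : realType) (m : nat) (S : compartmental_system R m)
    (i : 'I_m.+1) (j : 'I_m) : Prop :=
  forall v : R, 0 < v ->
    exists2 delta : R, 0 < delta & forall t, delta <= pipe S i j t v.

Definition condC6 (R : realType) (m : nat)
    (S : compartmental_system R m) : Prop :=
  forall i j, (forall t v, 0 <= v -> pipe S i j t v = 0) \/ carries S i j.

Definition outflow (R : realType) (m : nat) (S : compartmental_system R m)
    (j : 'I_m) : Prop := carries S ord0 j.

Definition zeta (R : realType) (m : nat) (S : compartmental_system R m)
    (J : set 'I_m) : set 'I_m :=
  \bigcup_(j in J) [set i | carries S (lift ord0 i) j].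

Definition irreducible_set (R : realType) (m : nat)
    (S : compartmental_system R m) (J : set 'I_m) : Prop :=
  [/\ J !=set0, zeta S J `<=` J &
      forall J' : set 'I_m, J' !=set0 -> J' `<` J -> ~ (zeta S J' `<=` J')].

Definition vanishes (R : realType) (m : nat) (S : compartmental_system R m)
    (x : transport R m -> history R m) (i : 'I_m) : Prop :=
  forall w, hull S w -> forall s, s <= 0 -> x w s ord0 i = 0.

(* Main.v *)
(* A point of K is determined by its present value: x(w)(s) = x(w . s)(0). For a
   set A of compartments that receives nothing from its complement, the mass
   carried by A (its D-part plus the material in its internal pipes) is
   nonnegative, and its derivative along an orbit is minus the material that
   leaves A. Hence it is constant on an omega-limit orbit; such an orbit is dense
   because the hull is minimal, so it is constant on K and nothing leaves A.
   This is applied to A = I and to A = J_0. Conversely, if x_i vanishes then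
   D_i = 0, so nothing enters C_i, and every C_j that feeds C_i is empty as well:
   the set of nonempty compartments is closed under zeta. *)
Require Import Defs.
From mathcomp Require Import all_boot all_order all_algebra.
From mathcomp Require Import all_classical all_reals all_analysis.
From mathcomp Require Import measurable_realfun ring lra.
Import Order.TTheory GRing.Theory Num.Theory.
Import numFieldNormedType.Exports.
Local Open Scope classical_set_scope.
Local Open Scope ring_scope.

(** The sign condition on [K] concerns D and not x, so the nonnegativity of x has to be recovered
    first: [Dop] >= 0 bounds x_i from below by integrals of the x_j against nu_ij, whose rows have
    total mass below 1, and this bound is iterated. Only then are the flows, the pipe contents and
    the leak known to be nonnegative. The delays are unbounded, so the content of a pipe may grow
    linearly with the delay. The finite first moment of mu_ij makes it integrable; both the
    differentiation of the mass along an orbit and its continuity on the hull rest on that. The last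
    obstacle is that vanishing arrivals at C_i inform about x_j only mu_ij-almost everywhere, and
    mu_ij need not charge any neighbourhood of time 0. The conclusion on the present value of x_j
    comes from using all translates of w at once. *)

(** * Antiderivatives of continuous functions on the whole line *)

Section Antiderivative.
Context {R : realType}.
Local Notation leb := (@lebesgue_measure R).

Lemma continuous_integrable_segment (q : R -> R) (a b : R) : continuous q ->
  leb.-integrable `[a, b] (EFin \o q).
Proof.
move=> cq; apply: continuous_compact_integrable; first exact: segment_compact.
exact: continuous_subspaceT.
Qed.

Lemma antiderivative_exists (q : R -> R) : continuous q ->
  exists Q : R -> R, forall t, is_derive t (1 : R) Q (q t).
Proof.
move=> cq.
(* This is the oriented integral from 0 to t: for t other than 0, exactly one of the two segments is
   empty. *)
exists (fun t => \int[leb]_(r in `[0, t]) q r - \int[leb]_(r in `[t, 0]) q r).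
move=> t.
(* With a base point to the left of both t and 0, the oriented integral is [G - G 0] near t,
   whatever the sign of t. *)
pose a := Num.min t 0 - 1.
have [at_ a0] : a < t /\ a < 0.
  by rewrite /a minEle; case: (leP t 0) => ?; split; lra.
pose G t := \int[leb]_(r in `[a, t]) q r.
have [dG G'] : derivable G t 1 /\ derive1 G t = q t.
  apply: (@continuous_FTC1_closed _ q a t (t + 1)).
  - by rewrite ltrDl.
  - exact: continuous_integrable_segment.
  - exact: at_.
  - exact: cq.
have isG : is_derive t (1 : R) (fun t => G t - G 0) (q t).
  rewrite -[q t]subr0; apply: is_deriveB.
  by rewrite -G' derive1E; exact/derivableP.
apply: (@near_eq_is_derive _ _ _ (fun t => G t - G 0)) => //.
near=> u.
have au : a < u by near: u; exact: lt_nbhsr.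
rewrite /G; have [u0|u0] := leP 0 u.
  rewrite (@Rintegral_itvB _ q (BLeft a) (BRight u) 0) ?bnd_simp ?(ltW a0)//;
    last first.
    exact: continuous_integrable_segment.
  rewrite Rintegral_itv_obnd_cbnd; last first.
    apply: integrableS (continuous_integrable_segment q 0 u cq) => //.
    by apply: subset_itvr; rewrite bnd_simp.
  have [->|u0'] := eqVneq u 0; first by rewrite set_itv1 Rintegral_set1 subr0.
  by rewrite [in X in _ - X]set_itv_ge ?Rintegral_set0 ?subr0// bnd_simp -ltNge
    lt_neqAle eq_sym u0'.
rewrite [in RHS]set_itv_ge ?Rintegral_set0 ?sub0r ?bnd_simp -?ltNge//.
rewrite -opprB; congr (- _).
rewrite (@Rintegral_itvB _ q (BLeft a) (BRight 0) u) ?bnd_simp ?(ltW au)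
  ?(ltW u0)//; last first.
  exact: continuous_integrable_segment.
rewrite Rintegral_itv_obnd_cbnd//.
apply: integrableS (continuous_integrable_segment q u 0 cq) => //.
by apply: subset_itvr; rewrite bnd_simp.
Unshelve. all: by end_near. Qed.

Lemma is_derive1_shift (Q q : R -> R) (s : R) :
  (forall t, is_derive t (1 : R) Q (q t)) ->
  forall t, is_derive t (1 : R) (fun t => Q (t + s)) (q (t + s)).
Proof.
move=> dQ t; rewrite -[q _]mulr1.
by apply: (@is_derive1_comp _ Q (fun t => t + s));
  rewrite -[X in is_derive _ _ _ X]addr0; exact: is_deriveD.
Qed.

Lemma is_derive1_continuous (Q q : R -> R) :
  (forall t, is_derive t (1 : R) Q (q t)) -> continuous Q.
Proof.
move=> dQ t; apply: differentiable_continuous; apply/derivable1_diffP.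
by have [] := dQ t.
Qed.

Lemma Rintegral_is_derive1 (Q q : R -> R) (a b : R) : continuous q ->
  (forall t, is_derive t (1 : R) Q (q t)) -> a <= b ->
  \int[leb]_(r in `[a, b]) q r = Q b - Q a.
Proof.
move=> cq dQ; rewrite le_eqVlt => /predU1P[->|ab].
  by rewrite set_itv1 Rintegral_set1 subrr.
have cQ := is_derive1_continuous _ _ dQ.
rewrite /Rintegral (@continuous_FTC2 _ q Q)//.
- exact: continuous_subspaceT.
- split.
  + by move=> x _; have [] := dQ x.
  + exact/cvg_at_right_filter/cQ.
  + exact/cvg_at_left_filter/cQ.
- by move=> x _; rewrite derive1E; have [_ ->] := dQ x.
Qed.

Lemma is_derive1_lip (Q q : R -> R) (B : R) :
  (forall t, is_derive t (1 : R) Q (q t)) -> (forall t, `|q t| <= B) ->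
  forall a b, `|Q b - Q a| <= B * `|b - a|.
Proof.
move=> dQ qB; have H a b : a <= b -> `|Q b - Q a| <= B * `|b - a|.
  move=> ab; have cQ := is_derive1_continuous _ _ dQ.
  have [c _ ->] := MVT_segment ab (fun x _ => dQ x) (continuous_subspaceT cQ).
  by rewrite normrM ler_wpM2r.
move=> a b; have [/H//|/ltW/H] := leP a b.
by rewrite distrC [`|b - a|]distrC.
Qed.

Lemma is_derive1_nincr (Q q : R -> R) :
  (forall t, is_derive t (1 : R) Q (q t)) -> (forall t, q t <= 0) ->
  {homo Q : a b / b <= a >-> a <= b}.
Proof.
move=> dQ q0 b a ab; have cQ := is_derive1_continuous _ _ dQ.
  have [c _ h] := MVT_segment ab (fun x _ => dQ x) (continuous_subspaceT cQ).
by rewrite -subr_le0 h mulr_le0_ge0 ?subr_ge0.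
Qed.

End Antiderivative.

Lemma Rintegral_dominated_cvg d (T : measurableType d) (R : realType)
    (mu : {measure set T -> \bar R}) (D : set T)
    (f_ : (T -> R)^nat) (f g : T -> R) : measurable D ->
  (forall n, measurable_fun D (f_ n)) ->
  (forall s, D s -> f_ ^~ s @ \oo --> f s) ->
  mu.-integrable D (EFin \o g) ->
  (forall n s, D s -> `|f_ n s| <= g s) ->
  \int[mu]_(s in D) f_ n s @[n --> \oo] --> \int[mu]_(s in D) f s.
Proof.
move=> mD mf ff ig fg.
have mf_ : measurable_fun D f by apply: measurable_fun_cvg ff.
have iF : mu.-integrable D (EFin \o f).
  apply: (@le_integrable _ _ _ mu _ _ _ (EFin \o g)) => //.
    exact/measurable_EFinP.
  move=> s ps /=; rewrite lee_fin.
  apply: le_trans (ler_norm (g s)).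
  have /cvgr_to_le : `|f_ n s| @[n --> \oo] --> `|f s| by apply: cvg_norm;
    exact: ff.
  by apply; apply: nearW => n; exact: fg.
apply: fine_cvg; rewrite fineK; last exact: integrable_fin_num.
apply: (@dominated_cvg _ _ _ mu _ _ (fun n => EFin \o f_ n) (EFin \o f)
  (EFin \o g)) => //.
- by move=> n; exact/measurable_EFinP.
- move=> s ps /=; apply: cvg_EFin; [exact: nearW|exact: ff].
Qed.

Lemma measurable_past (R : realType) :
  measurable (past R : set (measurableTypeR R)).
Proof. exact: measurable_itv. Qed.
#[local] Hint Resolve measurable_past : core.

(** * Integration against a finite measure on the past *)

Section PastMeasure.
Context {R : realType} (mu : {finite_measure set (measurableTypeR R) ->
  \bar R}).
Implicit Types q Q f g : R -> R.

Lemma integrable_past_bounded f B : measurable_fun (past R) f ->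
  (forall s, past R s -> `|f s| <= B) -> mu.-integrable (past R) (EFin \o f).
Proof.
move=> mf fB; apply: (@le_integrable _ _ _ mu _ _ _ (EFin \o cst B)) => //.
- exact/measurable_EFinP.
- move=> s /fB h /=; rewrite lee_fin (le_trans h)// ler_norm//.
- apply: finite_measure_integrable_cst => //.
Qed.

Lemma continuous_measurable_past q : continuous q -> measurable_fun (past R) q.
Proof. by move=> cq; apply: measurable_funTS;
  exact: continuous_measurable_fun. Qed.

Lemma integrable_past_continuous q B : continuous q ->
  (forall s, `|q s| <= B) ->
  mu.-integrable (past R) (EFin \o q).
Proof.
move=> cq qB; apply: (@integrable_past_bounded _ B) => //.
exact: continuous_measurable_past.
Qed.

Hypothesis mu_first_moment : (\int[mu]_(s in past R) `|s|%:E < +oo)%E.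

(** Meant for pipe contents: with a bounded flow, the material in transit with delay |s| is at most
    a multiple of |s|, which the first moment makes integrable. *)
Lemma integrable_past_lip f B : measurable_fun (past R) f ->
  (forall s, past R s -> `|f s| <= B * `|s|) ->
    mu.-integrable (past R) (EFin \o f).
Proof.
move=> mf fB.
have iabs : mu.-integrable (past R) (fun s => (B * `|s|)%:E).
  under eq_fun do rewrite EFinM; apply: integrableZl => //.
  apply/integrableP; split; first by apply/measurable_EFinP;
    apply: continuous_measurable_past; exact: norm_continuous.
  by under eq_integral do rewrite /= normr_id.
apply: (@le_integrable _ _ _ mu _ _ _ (fun s => (B * `|s|)%:E)) => //.
- exact/measurable_EFinP.
- by move=> s /fB h /=; rewrite lee_fin (le_trans h)// ler_norm.
Qed.

(** The integrand is unbounded in s but is dominated by [B * |s|], and its derivative in t by the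
    constant [B + B]; the first moment and the finiteness of the measure thus justify
    differentiating under the integral. *)
Lemma is_derive_past_integral Q q B : continuous q ->
  (forall t, is_derive t (1 : R) Q (q t)) -> (forall t, `|q t| <= B) ->
  forall t, is_derive t (1 : R)
    (fun t => \int[mu]_(s in past R) (Q t - Q (t + s)))
    (\int[mu]_(s in past R) (q t - q (t + s))).
Proof.
move=> cq dQ qB t.
have cQ := is_derive1_continuous _ _ dQ.
pose f t s := Q t - Q (t + s).
have df s u : is_derive u (1 : R) (f ^~ s) (q u - q (u + s)).
  by apply: is_deriveB; exact: is_derive1_shift.
have intf (u : R) : `]t - 1, t + 1[%classic u -> mu.-integrable (past R)
  (EFin \o f u).
  move=> _; apply: (@integrable_past_lip _ B).
    apply: continuous_measurable_past => s; apply: cvgB; first exact: cvg_cst.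
    apply: continuous_comp; [|exact: cQ].
    by apply: cvgD; [exact: cvg_cst|exact: cvg_id].
  move=> s _; rewrite /f distrC (le_trans (is_derive1_lip _ _ _ dQ qB _ _))//.
  by rewrite addrAC subrr add0r.
have intG : mu.-integrable (past R) (EFin \o cst (B + B)).
  exact: finite_measure_integrable_cst.
have B0 : 0 <= B by rewrite (le_trans _ (qB 0)).
have tI : `]t - 1, t + 1[%classic t by rewrite /= in_itv /= ltrBlDr ltrDl ltr01.
have D1 u s : partial1of2 f u s = q u - q (u + s).
  by rewrite /partial1of2 derive1E; have [_ ->] := df s u.
have df' (u s : R) : `]t - 1, t + 1[%classic u -> past R s ->
  derivable (f ^~ s) u 1.
  by move=> _ _; have [] := df s u.
have G0 (s : R) : 0 <= cst (B + B) s :> R by rewrite /= addr_ge0.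
have Gub (u s : R) : `]t - 1, t + 1[%classic u -> past R s -> `|partial1of2 f u
  s| <= cst (B + B) s.
  by move=> _ _; rewrite D1 (le_trans (ler_normB _ _))// lerD.
have mp := @measurable_past R.
apply: DeriveDef; first exact: (derivable_under_integral mp tI intf df'
  G0 intG Gub).
rewrite -derive1E (differentiation_under_integral mp tI intf df' G0 intG Gub).
by apply: eq_Rintegral => s _; exact: D1.
Qed.

End PastMeasure.

(** * The compact-convergence topology on transport functions, in epsilon form *)

Section Transport.
Context {R : realType} {m : nat}.
Implicit Types (w : transport R m) (N e : R).

(** These boxes form a base of neighbourhoods of w: [nbhs_box] and [nbhs_transport] are the two
    inclusions. *)
Definition box_close N e w w' := forall t v, `|t| <= N -> `|v| <= N ->
  ball (w (t, v)) e (w' (t, v)).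

Lemma box_closeS N N' e e' w w' : N' <= N -> e <= e' ->
  box_close N e w w' -> box_close N' e' w w'.
Proof.
move=> NN ee ww t v tN vN; apply: le_ball ee _ _.
by apply: ww; apply: le_trans NN.
Qed.

Lemma nbhs_box w N e : 0 < e -> nbhs w [set w' | box_close N e w w'].
Proof.
move=> e0.
have cB : compact (`[- N, N]%classic `*` `[- N, N]%classic : set (R * R)).
  by apply: compact_setX; exact: segment_compact.
have := @fam_nbhs _ _ compact _ [set p : flux R m * flux R m | ball p.1 e p.2]
  w.
move=> /(_ _ (entourage_ball _ (PosNum e0)) cB);
  apply: filterS => w' h t v tN vN.
by apply: (h (t, v)); split; rewrite /= in_itv /= -ler_norml.
Qed.

Lemma compact_box (A : set (R * R)) : compact A ->
  exists N, forall t v, A (t, v) -> `|t| <= N /\ `|v| <= N.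
Proof.
move=> /compact_bounded [M [Mr MA]]; exists (M + 1) => t v Atv.
have /= := MA (M + 1) _ _ Atv; rewrite ltrDl ltr01 => /(_ isT).
by rewrite prod_normE /= ge_max => /andP.
Qed.

(** A compact set of the plane lies in some box, so the filter generated by the boxes converges to w
    uniformly on every compact set. *)
Lemma nbhs_transport w (U : set (transport R m)) : nbhs w U ->
  exists N e, 0 < e /\ forall w', box_close N e w w' -> U w'.
Proof.
pose F : set_system (transport R m) :=
  filter_from [set p : R * R | 0 < p.2]
    (fun p => [set w' | box_close p.1 p.2 w w']).
have FF : Filter F.
  apply: filter_from_filter; first by exists (0, 1) => /=.
  move=> [N e] [N' e'] /= e0 e0'; exists (Num.max N N', Num.min e e') => /=.
    by rewrite lt_min e0.
  move=> w' h; split; apply: box_closeS h;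
    by rewrite ?le_max ?ge_min ?lexx ?orbT.
have /(_ _)/[apply] : F --> w.
  apply/fam_cvgP => A /compact_box [N hN] P /uniform_nbhs [E [entE EP]].
  move: entE; rewrite -entourage_ballE => -[e /= e0 eE].
  exists (N, e) => //= w' h; apply: EP => -[t v] /hN [tN vN].
  by apply: eE; exact: h.
by move=> [[N e] /= e0 h]; exists N, e.
Qed.

Lemma closure_box (O : set (transport R m)) w : closure O w <->
  forall N e, 0 < e -> exists2 w', O w' & box_close N e w w'.
Proof.
split=> [clO N e e0|h U /nbhs_transport [N [e [e0 hU]]]].
  by have [w' [Ow' ?]] := clO _ (nbhs_box w N e e0); exists w'.
by have [w' Ow' /hU Uw'] := h N e e0; exists w'.
Qed.

Lemma box_close_wpipe N e w w' i j t v : box_close N e w w' ->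
  `|t| <= N -> `|v| <= N -> `|wpipe w i j t v - wpipe w' i j t v| < e.
Proof. by move=> h tN vN; have [[_ /(_ i j)]] := h t v tN vN. Qed.

Lemma box_close_inflow N e w w' i t v : box_close N e w w' ->
  `|t| <= N -> `|v| <= N -> `|(w (t, v)).2 ord0 i - (w' (t, v)).2 ord0 i| < e.
Proof. by move=> h tN vN; have [_ [_ /(_ ord0 i)]] := h t v tN vN. Qed.

Lemma box_close_translate N e w w' a : box_close (N + `|a|) e w w' ->
  box_close N e (translate a w) (translate a w').
Proof.
move=> h t v tN vN; apply: h.
  by rewrite addrC (le_trans (ler_normD _ _))// lerD2r.
by rewrite (le_trans vN)// lerDl.
Qed.

Lemma translateD a b w : translate a (translate b w) = translate (b + a) w.
Proof. by apply/funext => -[t v]; rewrite /translate /= addrA. Qed.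

Lemma translate0 w : translate 0 w = w.
Proof. by apply/funext => -[t v]; rewrite /translate /= add0r. Qed.

End Transport.

(** * Properties of the pipes inherited by every element of the hull *)

Section Hull.
Context {R : realType} {m : nat} (S : compartmental_system R m).
Context (hC1 : condC1 S) (hI : forall i t, inflow S i t = 0).

Lemma hull_approx w N e : hull S w -> 0 < e ->
  exists a, box_close N e w (translate a (gtilde S)).
Proof. by move=> /closure_box/(_ N e)/[apply] -[_ [a _ <-]]; exists a. Qed.

(** The hypotheses on [pipe S] reach the hull through this approximation: the weak inequalities
    among them hold at all times, so they survive translation, and e is arbitrary. *)
Lemma hull_approx_wpipe w N e : hull S w -> 0 < e ->
  exists a, forall i j t v, `|t| <= N -> `|v| <= N ->
    `|wpipe w i j t v - pipe S i j (a + t) v| < e.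
Proof.
move=> hw e0; have [a h] := hull_approx w N e hw e0; exists a => i j t v tN vN.
by have := box_close_wpipe _ _ _ _ i j _ _ h tN vN;
  rewrite /wpipe /translate /= mxE.
Qed.

Lemma hull_wpipe0 w i j t : hull S w -> wpipe w i j t 0 = 0.
Proof.
move=> hw; apply/eqP; rewrite -normr_le0; apply/ler_addgt0Pr => e e0.
have [a /(_ i j t 0)] := hull_approx_wpipe w `|t| e hw e0.
have [_ _ _ ->] := hC1; rewrite subr0 normr0 => h.
by rewrite add0r; apply: ltW; exact: h.
Qed.

Lemma hull_wpipe_homo w i j t : hull S w -> {homo wpipe w i j t : v u / v <= u}.
Proof.
move=> hw v u vu; apply/ler_addgt0Pr => e e0.
have e2 : 0 < e / 2 by rewrite divr_gt0.
have [a /(_ i j t)h] := hull_approx_wpipe w (Num.max `|t| (Num.max `|v| `|u|))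
  _ hw e2.
have := h v; have := h u; rewrite !le_max !lexx !orbT => /(_ isT isT) +
  /(_ isT isT).
rewrite !ltr_norml => /andP[h1 h2] /andP[h3 h4].
have [_ _ /(_ i j (a + t) _ _ vu)h5 _] := hC1.
by lra.
Qed.

Lemma hull_wpipe_ge0 w i j t v : hull S w -> 0 <= v -> 0 <= wpipe w i j t v.
Proof. by move=> hw v0; rewrite -(hull_wpipe0 w i j t hw) hull_wpipe_homo. Qed.

Lemma hull_inflow w p i : hull S w -> (w p).2 ord0 i = 0.
Proof.
case: p => t v hw; apply/eqP; rewrite -normr_le0; apply/ler_addgt0Pr => e e0.
have [a h] := hull_approx w (Num.max `|t| `|v|) e hw e0.
have := box_close_inflow _ _ _ _ i t v h; rewrite /translate /= mxE
  hI subr0 add0r.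
by rewrite !le_max !lexx orbT => /(_ isT isT)/ltW.
Qed.

Lemma hull_carries i j v : carries S i j -> 0 < v ->
  exists2 delta : R, 0 < delta &
    forall w t, hull S w -> delta <= wpipe w i j t v.
Proof.
move=> cS /cS [d d0 hd]; exists d => // w t hw; apply/ler_addgt0Pr => e e0.
have [a /(_ i j t v)] := hull_approx_wpipe w (Num.max `|t| `|v|) _ hw e0.
rewrite !le_max !lexx orbT ltr_norml => /(_ isT isT) /andP[h1 h2].
by have := hd (a + t); lra.
Qed.

Lemma hull_no_pipe w i j t v : (forall t v, 0 <= v -> pipe S i j t v = 0) ->
  hull S w -> 0 <= v -> wpipe w i j t v = 0.
Proof.
move=> h0 hw v0; apply/eqP; rewrite -normr_le0; apply/ler_addgt0Pr => e e0.
have [a /(_ i j t v)] := hull_approx_wpipe w (Num.max `|t| `|v|) _ hw e0.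
by rewrite h0// subr0 add0r !le_max !lexx orbT => /(_ isT isT)/ltW.
Qed.

(** Admissibility bounds a pipe at a fixed volume only; monotonicity makes the bound at volume r
    valid on [0, r]. *)
Lemma hull_wpipe_bounded r :
  exists B, forall w i j t v, hull S w -> 0 <= v <= r ->
    `|wpipe w i j t v| <= B.
Proof.
have [adm _ _ _] := hC1.
have /choice[B hB] (ij : 'I_m.+1 * 'I_m) :
    exists B, forall t, `|pipe S ij.1 ij.2 t r| <= B.
  have [_ _ /(_ r)[_ [M [Mr MB]]] _] := adm ij.1 ij.2.
  by exists (M + 1) => t; apply: MB => //; rewrite ltrDl.
(* The sum serves all pipes at once; the extra 1 absorbs the distance from w to a translate of
   [gtilde S]. *)
pose C := \sum_ij `|B ij|; exists (C + 1) => w i j t v hw /andP[v0 vr].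
rewrite ger0_norm ?hull_wpipe_ge0//
  (le_trans (hull_wpipe_homo w i j t hw _ _ vr))//.
have [a /(_ i j t r)] := hull_approx_wpipe w (Num.max `|t| `|r|) _ hw ltr01.
rewrite !le_max !lexx orbT ltr_norml => /(_ isT isT) /andP[h1 h2].
suff : pipe S i j (a + t) r <= C by lra.
apply: le_trans (ler_norm _) _; apply: le_trans (hB (i, j) _) _.
rewrite /C (bigD1 (i, j))//= (le_trans (ler_norm _))// lerDl sumr_ge0//.
Qed.

(* A function continuous in each variable and monotone in the second one is
   jointly continuous: it is squeezed between its values at [v0 - d] and
   [v0 + d], which are continuous in time. *)
Lemma pipe_jointly_continuous i j t0 v0 (e : R) : 0 < e ->
  exists2 d : R, 0 < d &
  forall t v, `|t - t0| < d -> `|v - v0| < d ->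
    `|pipe S i j t v - pipe S i j t0 v0| < e.
Proof.
move=> e0.
have [/(_ i j)[dv _ ut _] _ mono _] := hC1.
have e2 : 0 < e / 2 by rewrite divr_gt0.
have cv : {for v0, continuous (pipe S i j t0)}.
  by apply: differentiable_continuous; apply/derivable1_diffP; exact: dv.
have [d d0 hd] : exists2 d : R, 0 < d & forall v, `|v - v0| <= d ->
    `|pipe S i j t0 v - pipe S i j t0 v0| < e / 2.
  move/cvgrPdist_lt : cv => /(_ _ e2) [d /= d0 hd].
  exists (d / 2); first by rewrite divr_gt0.
  move=> v vd; rewrite distrC; apply: hd => /=; rewrite distrC.
  by rewrite (le_lt_trans vd)// ltr_pdivrMr// mulr_natr mulr2n ltrDl.
have ct v : exists2 d' : R, 0 < d' & forall t, `|t - t0| < d' ->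
    `|pipe S i j t v - pipe S i j t0 v| < e / 2.
  have [+ _] := ut v; move=> /(_ _ (entourage_ball _ (PosNum e2))).
  rewrite /nbhs /= -entourage_ballE => -[d' /= d'0 h].
  exists d' => // t tt; have := h (t, t0); rewrite /ball /= => /(_ tt).
  exact.
have [d1 d10 h1] := ct (v0 - d); have [d2 d20 h2] := ct (v0 + d).
exists (Num.min d (Num.min d1 d2)); first by rewrite !lt_min d0 d10 d20.
move=> t v; rewrite !lt_min => /and3P[_ t1 t2] /and3P[vd _ _].
have := h1 _ t1; have := h2 _ t2.
have := hd (v0 - d); have := hd (v0 + d).
have -> : v0 + d - v0 = d by ring.
have -> : v0 - d - v0 = - d by ring.
rewrite normrN gtr0_norm// lexx => /(_ isT) + /(_ isT).
move: vd; rewrite !ltr_norml => /andP[vd1 vd2] /andP[? ?] /andP[? ?]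
  /andP[? ?] /andP[? ?].
have : pipe S i j t v <= pipe S i j t (v0 + d) by apply: mono; lra.
have : pipe S i j t (v0 - d) <= pipe S i j t v by apply: mono; lra.
move=> ? ?; apply/andP; split; lra.
Qed.

Lemma hull_wpipe_continuous w i j t0 v0 (e : R) : hull S w -> 0 < e ->
  exists2 d : R, 0 < d &
  forall t v, `|t - t0| < d -> `|v - v0| < d ->
    `|wpipe w i j t v - wpipe w i j t0 v0| < e.
Proof.
move=> hw e0; have e3 : 0 < e / 3 by rewrite divr_gt0.
(* The box contains the unit neighbourhood of (t0, v0), so that a single translate approximates w at
   both points compared. *)
pose N := Num.max (`|t0| + 1) (`|v0| + 1).
have [a ha] := hull_approx_wpipe w N _ hw e3.
have [d d0 hd] := pipe_jointly_continuous i j (a + t0) v0 _ e3.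
exists (Num.min d 1); first by rewrite lt_min d0 ltr01.
move=> t v; rewrite !lt_min => /andP[td t1] /andP[vd v1].
have tN : `|t| <= N.
  by rewrite /N le_max -[t](subrK t0) (le_trans (ler_normD _ _))//
    addrC lerD2l ltW.
have vN : `|v| <= N.
  rewrite /N le_max; apply/orP; right.
  by rewrite -[v](subrK v0) (le_trans (ler_normD _ _))// addrC lerD2l ltW.
have t0N : `|t0| <= N by rewrite /N le_max lerDl ler01.
have v0N : `|v0| <= N by rewrite /N le_max; apply/orP; right;
  rewrite lerDl ler01.
have := ha i j _ _ tN vN; have := ha i j _ _ t0N v0N.
have : `|a + t - (a + t0)| < d by rewrite opprD addrACA subrr add0r.
move/hd => /(_ _ vd); rewrite !ltr_norml => /andP[? ?] /andP[? ?] /andP[? ?].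
by apply/andP; split; lra.
Qed.

End Hull.

(** * Present values along the orbits of the minimal graph *)

Section MinimalGraph.
Context {R : realType} {m : nat} (S : compartmental_system R m).
Context (hC1 : condC1 S) (hC2 : condC2 S) (hC4 : condC4 S)
  (hI : forall i t, inflow S i t = 0).
Context (K : set (transport R m * history R m))
  (x : transport R m -> history R m)
  (hKx : K = [set (w, x w) | w in hull S])
  (hKmin : minimal_set (positively_invariant S) K)
  (hKpos : K `<=` hull S `*` BUD_pos S).

Definition present (w : transport R m) (i : 'I_m) : R := x w 0 ord0 i.
Local Notation f := present.

Lemma hull_translate t w : hull S w -> hull S (translate t w).
Proof. by have [_ _ h _] := hC2; exact: h. Qed.

Lemma hull_compact : compact (hull S).
Proof. by have [_ h _ _] := hC2. Qed.

Lemma graph_mem w : hull S w -> K (w, x w).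
Proof. by move=> hw; rewrite hKx; exists w. Qed.

Lemma graph_memE w y : K (w, y) -> hull S w /\ y = x w.
Proof. by rewrite hKx => -[w' hw' [<- <-]]. Qed.

Lemma graph_BU w : hull S w -> BU (x w).
Proof. by move=> /graph_mem/hKpos[_ []]. Qed.

Lemma graph_solution w : hull S w -> exists z, is_solution S w (x w) z /\
  forall t, 0 <= t -> segment z t = x (translate t w).
Proof.
have [_ _ inv _] := hKmin; move=> /graph_mem/inv[z [sz h]].
by exists z; split => // t /h/graph_memE[].
Qed.

(** Solutions run forward only, so one starts over [translate s w] and waits for time [- s]: the
    history reached is [x w], and its value at s is the initial present. *)
Lemma graph_history w s : hull S w -> s <= 0 -> x w s = x (translate s w) 0.
Proof.
move=> hw s0; have [z [_ h]] := graph_solution _ (hull_translate s w hw).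
have h1 : segment z (- s) = x w by rewrite h ?oppr_ge0// translateD
  subrr translate0.
have h2 : segment z 0 = x (translate s w) by rewrite h// translate0.
rewrite -[in LHS]h1 -[in RHS]h2 /segment (min_idPl s0) minxx.
by congr z; ring.
Qed.

Lemma graph_segment w s : hull S w -> s <= 0 ->
  segment (x w) s = x (translate s w).
Proof.
move=> hw s0; apply/funext => r; rewrite /segment.
have hsw := hull_translate s w hw.
have [r0|r0] := leP r 0.
  rewrite [LHS]graph_history ?nmulrn_rle0 -?oppr_ge0 ?opprD
    ?addr_ge0 ?oppr_ge0//.
  by rewrite [RHS]graph_history// translateD.
have [/(_ r (ltW r0)) -> _ _] := graph_BU _ hsw.
by rewrite addr0; exact: graph_history.
Qed.

Lemma graph_D_ge0 w i : hull S w -> 0 <= Dop S i (x w).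
Proof.
move=> hw; have [_ [_ /(_ i 0 (lexx 0))]] := hKpos _ (graph_mem _ hw).
by rewrite graph_segment// translate0.
Qed.

Lemma graph_past w s i : hull S w -> past R s -> x w s ord0 i =
  f (translate s w) i.
Proof. by move=> hw ps; rewrite graph_history//; move: ps;
  rewrite /past /= in_itv. Qed.

Lemma graph_D w i : hull S w -> Dop S i (x w) =
  f w i - \sum_(j < m) \int[nu S i j]_(s in past R) f (translate s w) j.
Proof.
move=> hw; congr (_ - _); apply: eq_bigr => j _; apply: eq_Rintegral => s.
by rewrite inE => ps; exact: graph_past.
Qed.

Lemma history_eval_continuous : continuous (fun y : history R m => y 0).
Proof.
move=> y B; rewrite nbhsE => -[U [oU Uy] UB].
have := @compact_open_open R 'rV[R]_m [set 0] U (@compact_set1 _ 0) oU.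
rewrite openE => /(_ y) h.
have {}h : nbhs y [set g : history R m | g @` [set 0] `<=` U].
  by apply: h => _ /= [_ -> <-].
by apply: filterS h => g /= h; apply: UB; apply: h; exists 0.
Qed.

Lemma history_coord_continuous i :
  continuous (fun y : history R m => y 0 ord0 i).
Proof.
move=> y; apply: (@continuous_comp _ _ _ (fun y : history R m => y 0)
  (fun v => v ord0 i)).
  exact: history_eval_continuous.
exact: coord_continuous.
Qed.

Lemma present_bounded : exists r : R, forall w i, hull S w -> `|f w i| <= r.
Proof.
have [_ cK _ _] := hKmin.
have /choice[r hr] (i : 'I_m) : exists r : R, forall w, hull S w ->
  `|f w i| <= r.
  have cg : continuous (fun p : transport R m * history R m => p.2 0 ord0 i).
    move=> p; apply: (@continuous_comp _ _ _ snd
      (fun y : history R m => y 0 ord0 i)).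
      exact: cvg_snd.
    exact: history_coord_continuous.
  have := @continuous_compact _ _ _ K (continuous_subspaceT cg) cK.
  move=> /compact_bounded [M [Mr MK]]; exists (M + 1) => w hw.
  apply: (MK (M + 1)); first by rewrite ltrDl.
  by exists (w, x w) => //; exact: graph_mem.
exists (\sum_i `|r i|) => w i hw; rewrite (le_trans (hr i w hw))//.
by rewrite (bigD1 i)//= (le_trans (ler_norm _))// lerDl sumr_ge0.
Qed.

Lemma present_orbit_continuous w i : hull S w ->
  continuous (fun t => f (translate t w) i).
Proof.
(* Seen from time t0 + 1, all times near t0 lie in the past, where uniform continuity of a [BU]
   history controls both sides of t0. *)
move=> hw t0; pose w' := translate (t0 + 1) w.
have hw' : hull S w' by exact: hull_translate.
have [_ _ uc] := graph_BU _ hw'.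
apply/cvgrPdist_lt => e e0.
have := uc _ (entourage_ball _ (PosNum e0)).
rewrite /nbhs /= -entourage_ballE => -[d /= d0 h].
apply/nbhs_ballP; exists (Num.min d 1) => /=; first by rewrite lt_min d0 ltr01.
move=> t; rewrite /ball /= lt_min => /andP[td].
rewrite ltr_norml => /andP[t1 _].
have E u : u <= t0 + 1 -> f (translate u w) i = x w' (u - (t0 + 1)) ord0 i.
  move=> ut; rewrite graph_history ?subr_le0//.
  by rewrite translateD addrC subrK.
rewrite !E ?lerDl//; last by lra.
have tb : ball (t0 - (t0 + 1)) d (t - (t0 + 1)).
  by rewrite /ball /= (_ : _ - _ - _ = t0 - t)//; ring.
by have [_ /(_ ord0 i)] := h (_, _) tb.
Qed.

Lemma ball_eq0 (V : normedModType R) (a b : V) :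
  (forall e : R, 0 < e -> ball a e b) -> a = b.
Proof.
move=> h; apply/eqP; rewrite -subr_eq0 -normr_le0; apply/ler_addgt0Pr => e e0.
by have := h _ e0; rewrite -ball_normE /ball_ /= add0r => /ltW.
Qed.

(* Compactness of the graph [K] makes [x], hence [present], continuous. *)
Lemma present_continuous w i (e : R) : hull S w -> 0 < e ->
  exists N d : R, 0 < d /\ forall w', hull S w' -> box_close N d w w' ->
    `|f w' i - f w i| < e.
Proof.
move=> hw e0; apply: contrapT => hn.
(* If no box works, these sets generate a proper filter on the compact [K]. It clusters at a point
   lying over w, which is [(w, x w)] since [K] is a graph; but there the present is within e of
   [f w i]. *)
pose bad (p : R * R) : set (transport R m * history R m) :=
  [set q | exists w', [/\ hull S w', box_close p.1 p.2 w w',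
    e <= `|f w' i - f w i| & q = (w', x w')]].
pose F := filter_from [set p : R * R | 0 < p.2] bad.
have FF : ProperFilter F.
  apply: filter_from_proper; last first.
    move=> [N d] /= d0; apply: contrapT => h; apply: hn;
      exists N, d; split => //.
    move=> w' hw' ww'; rewrite ltNge; apply/negP => le_e; apply: h.
    by exists (w', x w'), w'.
  apply: filter_from_filter; first by exists (0, 1) => /=.
  move=> [N d] [N' d'] /= d0 d0'; exists (Num.max N N', Num.min d d') => /=.
    by rewrite lt_min d0.
  move=> _ [w' [hw' cw' ew' ->]]; split; exists w'; split => //=;
    by apply: box_closeS cw'; rewrite ?le_max ?ge_min ?lexx ?orbT.
have [_ cK _ _] := hKmin.
have FK : F K.
  by exists (0, 1) => //= _ [w' [hw' _ _ ->]]; exact: graph_mem.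
have [[w1 y1] [/graph_memE[hw1 ->{y1}] clF]] := cK F FF FK.
have ww1 : w1 = w.
  apply/funext => -[t v]; apply: ball_eq0 => d d0; have d2 :
    0 < d / 2 by rewrite divr_gt0.
  pose N := Num.max `|t| `|v|.
  have Fb : F (bad (N, d / 2)) by exists (N, d / 2).
  have nb : nbhs (w1, x w1) [set q : transport R m * history R m | box_close N
    (d / 2) w1 q.1].
    by exists ([set w' | box_close N (d / 2) w1 w'], setT) => /=;
      [split; [exact: nbhs_box|exact: filterT]|move=> [a b] [/=]].
  have [_ [[w' [_ cw _ ->]] /= cw1]] := clF _ _ Fb nb.
  have tN : `|t| <= N by rewrite /N le_max lexx.
  have vN : `|v| <= N by rewrite /N le_max lexx orbT.
  rewrite [d]splitr; apply: ball_triangle (cw1 t v tN vN) _.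
  by apply: ball_sym; exact: cw.
have Fb : F (bad (0, 1)) by exists (0, 1) => /=.
have nb : nbhs (w1, x w1) [set q : transport R m * history R m | `|q.2 0 ord0
  i - f w i| < e].
  exists (setT, [set y : history R m | `|y 0 ord0 i - f w i| < e]) => /=;
    last by move=> [a b] [].
  split; first exact: filterT.
  have /cvgrPdist_lt/(_ e e0) := history_coord_continuous i (x w1).
  by rewrite ww1; apply: filterS => y; rewrite distrC.
have [_ [[w' [_ _ ew' ->]] /= ]] := clF _ _ Fb nb.
by rewrite -/(f w' i) ltNge ew'.
Qed.

(** If all present values are at least -a, then [graph_D_ge0] improves this to -(a kappa), where
    kappa < 1 is the largest row mass of nu. Iteration from the uniform bound r gives -(r kappa^n),
    which tends to 0. *)
Lemma present_ge0 w i : hull S w -> 0 <= f w i.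
Proof.
have [_ nu1] := hC4; have [r hr] := present_bounded.
have r0 : 0 <= r \/ ~ exists w, hull S w.
  have [[w' hw']|] := pselect (exists w', hull S w'); last by right.
  by left; exact: le_trans (hr _ i hw').
case: r0 => [r0|noh]; last by move=> hw; exfalso; apply: noh; exists w.
pose k j l := fine (nu S j l (past R)).
have k0 j l : 0 <= k j l by rewrite /k fine_ge0.
pose kappa := \big[Num.max/0]_(j < m) \sum_(l < m) k j l.
have kappa0 : 0 <= kappa by exact: bigmax_ge_id.
have kappa1 : kappa < 1.
  apply/bigmax_ltP; split => // j _; rewrite -lte_fin -sumEFin.
  apply: le_lt_trans (nu1 j); rewrite le_eqVlt; apply/orP; left; apply/eqP.
  by apply: eq_bigr => l _; rewrite /k fineK// fin_num_measure.
have step a : 0 <= a -> (forall w j, hull S w -> - a <= f w j) ->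
    forall w j, hull S w -> - (a * kappa) <= f w j.
  move=> a0 ha w' j hw'.
  have := graph_D_ge0 w' j hw'; rewrite graph_D// subr_ge0; apply: le_trans.
  have -> : - (a * kappa) = (- a) * kappa by ring.
  apply: (@le_trans _ _ ((- a) * \sum_(l < m) k j l)).
    by rewrite !mulNr lerN2 ler_wpM2l// /kappa; exact: le_bigmax.
  rewrite mulr_sumr; apply: ler_sum => l _.
  rewrite /k -Rintegral_cst//; apply: le_Rintegral => //.
  - exact: finite_measure_integrable_cst.
  - apply: (@integrable_past_continuous _ _ _ r).
      exact: present_orbit_continuous.
    by move=> s; apply: hr; exact: hull_translate.
  - by move=> s _; apply: ha; exact: hull_translate.
have geo n : forall w j, hull S w -> - (r * kappa ^+ n) <= f w j.
  elim: n => [|n IH] w' j hw'.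
    by rewrite expr0 mulr1 lerNl (le_trans _ (hr w' j hw'))// -normrN ler_norm.
  by rewrite exprSr mulrA; apply: step => //; rewrite mulr_ge0// exprn_ge0.
move=> hw.
have : - (r * kappa ^+ n) @[n --> \oo] --> - (r * 0).
  apply: cvgN; apply: cvgM; first exact: cvg_cst.
  by apply: cvg_expr; rewrite ger0_norm.
by rewrite mulr0 oppr0 => /cvgr_to_le; apply; apply: nearW => n; exact: geo.
Qed.

Lemma is_derive_D w i t : hull S w ->
  is_derive t (1 : R) (fun t => Dop S i (x (translate t w)))
    (vector_field S i (translate t w) (x (translate t w))).
Proof.
(* A solution has only a right derivative at its initial time. Starting one unit earlier places t at
   time 1, where the derivative is two-sided. *)
move=> hw; pose w' := translate (t - 1) w.
have [z [[_ _ /(_ i 1 ler01) H] hz]] := graph_solution w'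
  (hull_translate _ _ hw).
have E r : 0 <= r -> segment z r = x (translate (t - 1 + r) w).
  by move=> r0; rewrite hz// translateD.
rewrite !E ?ler01// in H *; rewrite translateD !subrK in H.
set V := vector_field _ _ _ _ in H *.
set D := fun t => _.
have L : h^-1 *: (D (h *: (1 : R) + t) - D t) @[h --> (0 : R)^'] --> V.
  apply/cvgrPdist_lt => e e0.
  have /cvgrPdist_lt/(_ e e0) H1 := H.
  have {}H1 : \forall r \near (1 : R), r != 1 -> 0 <= r ->
    `|V - (D (t - 1 + r) - D t) / (r - 1)| < e.
    apply: (@filterS _ (nbhs (1 : R)) _ _ _ _ H1) => r h r1 r0;
      rewrite /D -E//; apply: h => //.
    by rewrite /= in_itv /= r0.
  move/nbhs_ballP : H1 => [d /= d0 h].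
  apply/nbhs_ballP; exists (Num.min d 1) => /=;
    first by rewrite lt_min d0 ltr01.
  move=> u; rewrite /ball /= sub0r normrN lt_min => /andP[ud u1] u0.
  have -> : u *: 1 + t = t - 1 + (1 + u) by rewrite [u *: 1]mulr1; ring.
  rewrite [_ *: _]mulrC (_ : u^-1 = (1 + u - 1)^-1); last by congr (_^-1); ring.
  apply: h.
  - by rewrite /ball /= opprD addrA subrr add0r normrN.
  - by rewrite -subr_eq0 addrAC subrr add0r.
  - by move: u1; rewrite ltr_norml => /andP[? _]; lra.
by apply: DeriveDef; [apply/cvg_ex; exists V|apply/cvg_lim].
Qed.

(** Rate at which material enters the pipe from C_j to node k at time t, along the orbit of w. *)
Definition flow (w : transport R m) (k : 'I_m.+1) (j : 'I_m) (t : R) : R :=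
  wpipe w k j t (f (translate t w) j).
Local Notation q := flow.

Lemma flow_translate a w k j t : q (translate a w) k j t = q w k j (a + t).
Proof. by rewrite /flow translateD. Qed.

Lemma flow_ge0 w k j t : hull S w -> 0 <= q w k j t.
Proof.
move=> hw; apply: (@hull_wpipe_ge0 _ _ S) => //; apply: present_ge0.
exact: hull_translate.
Qed.

Lemma flow_continuous w k j : hull S w -> continuous (q w k j).
Proof.
move=> hw t; apply/cvgrPdist_lt => e e0.
have [d d0 hd] := hull_wpipe_continuous S hC1 w k j t
  (f (translate t w) j) e hw e0.
have /cvgrPdist_lt/(_ d d0) fd := present_orbit_continuous w j hw t.
have td : \forall u \near t, `|t - u| < d.
  by apply/nbhs_ballP; exists d.
apply: filterS2 fd td => u fd td.
by rewrite distrC; apply: hd; rewrite distrC.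
Qed.

Lemma flow_bounded : exists B : R, forall w k j t, hull S w ->
  `|q w k j t| <= B.
Proof.
have [r hr] := present_bounded; have [B hB] := hull_wpipe_bounded S hC1 r.
exists B => w k j t hw; apply: hB => //.
have hw' := hull_translate t w hw.
by rewrite present_ge0//= (le_trans _ (hr _ j hw'))// ler_norm.
Qed.

Lemma graph_flow w k j s : hull S w -> past R s ->
  wpipe w k j s (x w s ord0 j) = q w k j s.
Proof. by move=> hw ps; rewrite graph_past. Qed.

Lemma graph_vector_field w i : hull S w -> vector_field S i w (x w) =
  - q w ord0 i 0 - \sum_(j < m) q w (lift ord0 j) i 0
  + \sum_(j < m) \int[mu S i j]_(s in past R) q w (lift ord0 i) j s.
Proof.
move=> hw; rewrite /vector_field /winflow (hull_inflow S hI)// addr0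
  /flow translate0.
congr (_ + _); apply: eq_bigr => j _; apply: eq_Rintegral => s.
by rewrite inE => ps; rewrite graph_flow.
Qed.

(* Locally uniform convergence, i.e. convergence in [transport R m]. *)
Definition box_cvg (u : nat -> transport R m) w :=
  forall N e : R, 0 < e -> \forall n \near \oo, box_close N e w (u n).

Lemma box_cvg_translate a u w : box_cvg u w ->
  box_cvg (fun n => translate a (u n)) (translate a w).
Proof.
move=> uw N e e0; have := uw (N + `|a|) e e0; apply: filterS => n.
exact: box_close_translate.
Qed.

Lemma box_cvg_seq (u : nat -> transport R m) w :
  (forall n, box_close n%:R n.+1%:R^-1 w (u n)) -> box_cvg u w.
Proof.
move=> h N e e0; near=> n; apply: box_closeS (h n).
  by near: n; exact: nbhs_infty_ger.
by apply: ltW; near: n; exact: near_infty_natSinv_lt (PosNum e0).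
Unshelve. all: by end_near. Qed.

Lemma present_cvg u w i : (forall n, hull S (u n)) -> hull S w -> box_cvg u w ->
  f (u n) i @[n --> \oo] --> f w i.
Proof.
move=> hu hw uw.
apply/cvgrPdist_lt => e e0.
have [N [d [d0 h]]] := present_continuous w i e hw e0.
by have := uw N d d0; apply: filterS => n /(h _ (hu n)); rewrite distrC.
Qed.

Lemma present_orbit_cvg u w i s : (forall n, hull S (u n)) -> hull S w ->
  box_cvg u w -> f (translate s (u n)) i @[n --> \oo] --> f (translate s w) i.
Proof.
move=> hu hw uw; apply: (present_cvg (fun n => translate s (u n))
  (translate s w)).
- by move=> n; exact: hull_translate.
- exact: hull_translate.
- exact: box_cvg_translate.
Qed.

Lemma flow_cvg u w k j t : (forall n, hull S (u n)) -> hull S w ->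
  box_cvg u w -> q (u n) k j t @[n --> \oo] --> q w k j t.
Proof.
move=> hu hw uw; apply/cvgrPdist_lt => e e0.
have e2 : 0 < e / 2 by rewrite divr_gt0.
have [r hr] := present_bounded.
have [d d0 hd] := hull_wpipe_continuous S hC1 w k j t
  (f (translate t w) j) _ hw e2.
have /cvgrPdist_lt/(_ d d0) fd := present_orbit_cvg u w j t hu hw uw.
(* Both the transport function and its argument vary with n; the box has to contain t and all
   present values. *)
have := uw (Num.max `|t| r) _ e2.
apply: filterS2 fd => n fd bc.
have fr : `|f (translate t (u n)) j| <= Num.max `|t| r.
  by rewrite le_max hr ?orbT//; exact: hull_translate.
have tr : `|t| <= Num.max `|t| r by rewrite le_max lexx.
have := box_close_wpipe _ _ _ _ k j _ _ bc tr fr.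
have : `|t - t| < d by rewrite subrr normr0.
move/hd => /(_ (f (translate t (u n)) j)).
rewrite distrC fd => /(_ isT); rewrite -/(q w k j t) -/(q (u n) k j t).
rewrite !ltr_norml => /andP[? ?] /andP[? ?]; apply/andP; split; lra.
Qed.

Lemma flow_int_ge0 w k j s : hull S w ->
  0 <= \int[@lebesgue_measure R]_(r in `[s, 0]) q w k j r.
Proof. by move=> hw; apply: Rintegral_ge0 => r _; exact: flow_ge0. Qed.

(** One antiderivative serves every t of the orbit, which makes the inner integral a difference that
    can be differentiated in t. *)
Lemma flow_int w k j Q s t : hull S w ->
  (forall t, is_derive t (1 : R) Q (q w k j t)) -> past R s ->
  \int[@lebesgue_measure R]_(r in `[s, 0]) q (translate t w) k j r =
    Q t - Q (t + s).
Proof.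
move=> hw dQ; rewrite /past /= in_itv /= => s0.
have dQt : forall r, is_derive r (1 : R) (fun r => Q (r + t))
  (q (translate t w) k j r).
  by move=> r; rewrite flow_translate addrC; exact: is_derive1_shift.
rewrite (Rintegral_is_derive1 _ _ _ _
  (flow_continuous _ _ _ (hull_translate t w hw)) dQt)//.
by rewrite add0r [s + t]addrC.
Qed.

Lemma flow_int_bound B w k j s : (forall w k j t, hull S w ->
  `|q w k j t| <= B) ->
  hull S w -> past R s ->
  `|\int[@lebesgue_measure R]_(r in `[s, 0]) q w k j r| <= B * `|s|.
Proof.
move=> qB hw ps; have [Q dQ] := antiderivative_exists _
  (flow_continuous w k j hw).
have := flow_int w k j Q s 0 hw dQ ps; rewrite translate0 => ->.
have := is_derive1_lip _ _ _ dQ (fun t => qB w k j t hw) (0 + s) 0.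
by rewrite add0r sub0r normrN.
Qed.

Lemma flow_int_measurable w k j : hull S w ->
  measurable_fun (past R) (fun s => \int[@lebesgue_measure R]_(r in `[s, 0])
    q w k j r).
Proof.
move=> hw; have [Q dQ] := antiderivative_exists _ (flow_continuous w k j hw).
have cQ := is_derive1_continuous _ _ dQ.
apply: (@eq_measurable_fun _ _ _ _ _ (fun s => Q 0 - Q s)).
  move=> s; rewrite inE => ps.
  by have := flow_int w k j Q s 0 hw dQ ps; rewrite translate0 add0r.
apply: continuous_measurable_past => s; apply: cvgB; [exact: cvg_cst|exact: cQ].
Qed.

(** * Mass balance of a set A of compartments *)

Section Mass.
Context (hC3 : condC3 S) (A : pred 'I_m).

Definition mass (w : transport R m) : R :=
  \sum_(i < m | A i) Dop S i (x w) +
  \sum_(i < m | A i) \sum_(j < m | A j) \int[mu S j i]_(s in past R)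
    (\int[@lebesgue_measure R]_(r in `[s, 0]) q w (lift ord0 j) i r).

Definition leak (w : transport R m) : R :=
  \sum_(i < m | A i) (q w ord0 i 0 + \sum_(j < m | ~~ A j) q w
    (lift ord0 j) i 0).

Lemma mass_ge0 w : hull S w -> 0 <= mass w.
Proof.
move=> hw; apply: addr_ge0; first by apply: sumr_ge0 => i _; exact: graph_D_ge0.
apply: sumr_ge0 => i _; apply: sumr_ge0 => j _; apply: Rintegral_ge0 => s _.
exact: flow_int_ge0.
Qed.

Lemma sum_is_derive (F : 'I_m -> R -> R) (dF : 'I_m -> R)
  (P : pred 'I_m) (t : R) :
  (forall i, P i -> is_derive t (1 : R) (F i) (dF i)) ->
  is_derive t (1 : R) (fun t => \sum_(i < m | P i) F i t)
    (\sum_(i < m | P i) dF i).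
Proof.
move=> h; elim: (index_enum _) => [|i r IH].
  rewrite big_nil (_ : (fun _ => _) = cst 0); first exact: is_derive_cst.
  by apply/funext => u; rewrite big_nil.
rewrite big_cons (_ : (fun _ => _) = (fun u => if P i
    then F i u + \sum_(j <- r | P j) F j u else \sum_(j <- r | P j) F j u));
      last first.
  by apply/funext => u; rewrite big_cons.
by case: ifPn => // Pi; apply: is_deriveD => //; exact: h.
Qed.

Lemma sum_cvg (F : 'I_m -> nat -> R) (l : 'I_m -> R) (P : pred 'I_m) :
  (forall i, P i -> F i n @[n --> \oo] --> l i) ->
  \sum_(i < m | P i) F i n @[n --> \oo] --> \sum_(i < m | P i) l i.
Proof.
move=> h; elim: (index_enum _) => [|i r IH].
  by under eq_fun do rewrite big_nil; rewrite big_nil; exact: cvg_cst.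
under eq_fun do rewrite big_cons; rewrite big_cons.
by case: ifPn => // Pi; apply: cvgD => //; exact: h.
Qed.

(** The content of a pipe changes by what enters now minus what arrives now. Since mu has total mass
    1, the entering rate may be moved under the integral. *)
Lemma is_derive_pipe_mass w i j t : hull S w ->
  is_derive t (1 : R) (fun t => \int[mu S j i]_(s in past R)
    (\int[@lebesgue_measure R]_(r in `[s, 0]) q (translate t w)
      (lift ord0 j) i r))
  (q w (lift ord0 j) i t - \int[mu S j i]_(s in past R) q (translate t w)
    (lift ord0 j) i s).
Proof.
move=> hw; have [B qB] := flow_bounded.
have qc := flow_continuous w (lift ord0 j) i hw.
have [Q dQ] := antiderivative_exists _ qc.
have [mu1 mufin] := hC3 j i.
have -> : (fun t => \int[mu S j i]_(s in past R)
    (\int[@lebesgue_measure R]_(r in `[s, 0]) q (translate t w)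
      (lift ord0 j) i r)) =
    (fun t => \int[mu S j i]_(s in past R) (Q t - Q (t + s))).
  apply/funext => u; apply: eq_Rintegral => s; rewrite inE => ps.
  exact: flow_int.
have -> : q w (lift ord0 j) i t - \int[mu S j i]_(s in past R)
  q (translate t w) (lift ord0 j) i s
   = \int[mu S j i]_(s in past R)
     (q w (lift ord0 j) i t - q w (lift ord0 j) i (t + s)).
  rewrite RintegralB//.
  - rewrite Rintegral_cst// (_ : fine _ = 1) ?mulr1;
    last exact: (congr1 fine mu1).
    congr (_ - _); apply: eq_Rintegral => s _.
    by rewrite flow_translate.
  - exact: finite_measure_integrable_cst.
  - apply: (@integrable_past_continuous _ _ _ B); last by move=> s; exact: qB.
    move=> s; apply: (continuous_comp _ (qc _)).
    by apply: cvgD; [exact: cvg_cst|exact: cvg_id].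
by apply: (is_derive_past_integral _ mufin _ _ B qc dQ) => u; exact: qB.
Qed.

Hypothesis no_inflow : forall i j, A i -> ~~ A j ->
  forall w t, hull S w -> q w (lift ord0 i) j t = 0.

(** Arrivals through the pipes inside A are gained by the compartments and lost by the pipes, and
    departures into those pipes are the reverse, so both cancel. Arrivals from outside A vanish by
    [no_inflow], and the remainder is the leak. *)
Lemma is_derive_mass w t : hull S w ->
  is_derive t (1 : R) (fun t => mass (translate t w)) (- leak (translate t w)).
Proof.
move=> hw; have hw' := hull_translate t w hw.
rewrite (_ : - leak _ = \sum_(i < m | A i) vector_field S i (translate t w)
  (x (translate t w))
  + \sum_(i < m | A i) \sum_(j < m | A j) (q w (lift ord0 j) i t
      - \int[mu S j i]_(s in past R) q (translate t w) (lift ord0 j) i s)).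
  apply: is_deriveD; apply: sum_is_derive => i _; first exact: is_derive_D.
  by apply: sum_is_derive => j _; exact: is_derive_pipe_mass.
have Eq k j : q w k j t = q (translate t w) k j 0 by rewrite flow_translate
  addr0.
under [in RHS]eq_bigr => i Ai.
  rewrite graph_vector_field// (bigID A)/= [X in _ + X](bigID A)/=.
  rewrite [X in _ + (_ + X)]big1; last first.
    move=> j nAj; under eq_Rintegral => s _ do rewrite no_inflow//.
    by rewrite Rintegral_cst ?mul0r//; exact: measurable_past.
  rewrite addr0.
  over.
under [X in _ = _ + X]eq_bigr => i Ai do rewrite sumrB.
rewrite /= sumrB big_split/= exchange_big/=.
under [X in _ = _ + (X - _)]eq_bigr => i Ai do under eq_bigr => j Aj
  do rewrite Eq.
rewrite addrACA subrr addr0 /leak -sumrN -big_split/=.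
by apply: eq_bigr => i Ai; ring.
Qed.

(** Locally uniform convergence gives only pointwise convergence over the unbounded past. Dominated
    convergence does the rest, with constant bounds for the D-part and the inner integrals, and
    [B * |s|] for the outer ones. *)
Lemma mass_cvg u w : (forall n, hull S (u n)) -> hull S w -> box_cvg u w ->
  mass (u n) @[n --> \oo] --> mass w.
Proof.
move=> hu hw uw; have [r hr] := present_bounded; have [B hB] := flow_bounded.
have mp := @measurable_past R.
apply: cvgD.
  apply: sum_cvg => i _; rewrite graph_D//.
  under eq_fun do rewrite graph_D//.
  apply: cvgB; first exact: present_cvg.
  apply: sum_cvg => j _.
  apply: (@Rintegral_dominated_cvg _ _ _ _ _ _ _ (cst r)) => //.
  - move=> n; apply: continuous_measurable_past.
    exact: present_orbit_continuous.
  - by move=> s _; exact: present_orbit_cvg.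
  - exact: finite_measure_integrable_cst.
  - by move=> n s _; apply: hr; exact: hull_translate.
apply: sum_cvg => i _; apply: sum_cvg => j _.
have [_ mufin] := hC3 j i.
apply: (@Rintegral_dominated_cvg _ _ _ (mu S j i) (past R)
    (fun n s => \int[@lebesgue_measure R]_(r in `[s, 0]) q (u n)
      (lift ord0 j) i r)
    _ (fun s : R => B * `|s|)) => //.
- by move=> n; exact: flow_int_measurable.
- move=> s _.
  apply: (@Rintegral_dominated_cvg _ _ _ _ _ _ _ (cst B)) => //.
  + move=> n; apply: measurable_funTS; apply: continuous_measurable_fun.
    exact: flow_continuous.
  + by move=> t _; exact: flow_cvg.
  + by apply: continuous_integrable_segment; exact: cst_continuous.
  + by move=> n t _; exact: hB.
- apply: (@integrable_past_lip _ _ mufin _ `|B|); last by move=> s _;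
  rewrite normrM normr_id.
  apply: continuous_measurable_past => s.
  by apply: cvgM; [exact: cvg_cst|exact: norm_continuous].
- by move=> n s ps; exact: flow_int_bound.
Qed.

End Mass.

(** * Dense orbits and omega-limit points in the hull *)

Lemma orbit_dense w w' : hull S w -> hull S w' ->
  exists a : nat -> R, box_cvg (fun n => translate (a n) w) w'.
Proof.
move=> hw hw'; have [_ cpt _ min] := hC2.
pose B := closure (range (fun t => translate t w)).
have BH : B `<=` hull S.
  have -> : hull S = closure (hull S) by apply/closure_id; rewrite /hull;
    exact: closed_closure.
  by apply: closureS => _ [t _ <-]; exact: hull_translate.
have Bw : B w by apply: subset_closure; exists 0 => //; rewrite translate0.
have Bc : compact B by apply: subclosed_compact cpt BH; exact: closed_closure.
have Bt : translation_invariant B.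
  move=> t v Bv; apply/closure_box => N e e0.
  move/closure_box : Bv => /(_ (N + `|t|) e e0)[_ [s _ <-] h].
  exists (translate (s + t) w); first by exists (s + t).
  by rewrite -translateD; exact: box_close_translate.
have BE : B = hull S by apply: min => //; exists w.
have : B w' by rewrite BE.
move/closure_box => h.
have /choice[a ha] (n : nat) : exists t, box_close n%:R n.+1%:R^-1 w'
  (translate t w).
  by have [|_ [t _ <-] ?] := h n%:R n.+1%:R^-1; [rewrite invr_gt0|exists t].
by exists a; exact: box_cvg_seq.
Qed.

Lemma orbit_omega_limit w : hull S w -> exists w', hull S w' /\
  exists a : nat -> R, (forall n, n%:R <= a n) /\ box_cvg
    (fun n => translate (a n) w) w'.
Proof.
move=> hw; pose F := (fun t => translate t w) @ (pinfty_nbhs R).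
have FH : F (hull S) by exists 0; split=> // t _; exact: hull_translate.
have [w' [hw' cw']] := hull_compact F _ FH.
exists w'; split => //.
have /choice[a ha] (n : nat) : exists t,
    n%:R <= t /\ box_close n%:R n.+1%:R^-1 w' (translate t w).
  have n0 : 0 < n.+1%:R^-1 :> R by rewrite invr_gt0.
  have Fn : F [set translate t w | t in [set t | n%:R <= t]].
    by exists n%:R; split => // t nt; exists t => //; exact: ltW.
  have [_ [[t nt <-] ?]] := cw' _ _ Fn (nbhs_box w' n%:R _ n0).
  by exists t.
by exists a; split => [n|]; [case: (ha n)|apply: box_cvg_seq => n;
  case: (ha n)].
Qed.

(** * Constancy of the mass and absence of leaks *)

Section MassConstant.
Context (hC3 : condC3 S) (A : pred 'I_m).
Hypothesis no_inflow : forall i j, A i -> ~~ A j ->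
  forall w t, hull S w -> q w (lift ord0 i) j t = 0.

Lemma leak_ge0 w : hull S w -> 0 <= leak A w.
Proof.
move=> hw; apply: sumr_ge0 => i _; apply: addr_ge0; first exact: flow_ge0.
by apply: sumr_ge0 => j _; exact: flow_ge0.
Qed.

Lemma mass_constant : exists2 c : R, 0 <= c & forall w, hull S w ->
  mass A w = c.
Proof.
have [[w hw] _ _ _] := hC2.
pose phi t := mass A (translate t w).
have phi_dec : {homo phi : a b / b <= a >-> a <= b}.
  apply: (is_derive1_nincr _ _ (fun t => is_derive_mass hC3 A no_inflow
    w t hw)) => t.
  by rewrite oppr_le0; apply: leak_ge0; exact: hull_translate.
have phi0 t : 0 <= phi t by apply: mass_ge0; exact: hull_translate.
pose c := inf (range phi).
have hi : has_inf (range phi).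
  by split; [exists (phi 0), 0|exists 0 => _ [t _ <-]].
have c0 : 0 <= c by apply: lb_le_inf; [exists (phi 0), 0|move=> _ [t _ <-]].
have [w' [hw' [a [an aw]]]] := orbit_omega_limit w hw.
(* For fixed b the times [a n + b] still tend to infinity, so the nonincreasing [phi] tends to its
   infimum along them: the mass is c on the whole orbit of w'. *)
have mw' b : mass A (translate b w') = c.
  have hu n : hull S (translate b (translate (a n) w)) by do 2
    apply: hull_translate.
  have L := mass_cvg hC3 A _ _ hu (hull_translate b w' hw')
    (box_cvg_translate b _ _ aw).
  suff L' : mass A (translate b (translate (a n) w)) @[n --> \oo] --> c.
    exact: (cvg_unique _ L L').
  apply/cvgrPdist_lt => e e0.
  have [_ [s _ <-] sc] := inf_adherent e0 hi.
  near=> n; rewrite translateD -/(phi _).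
  have cphi : c <= phi (a n + b) by apply: ge_inf;
    [exact: hi.2|exists (a n + b)].
  rewrite distrC ger0_norm ?subr_ge0// ltrBlDl; apply: le_lt_trans sc.
  apply: phi_dec; rewrite -lerBlDr (le_trans _ (an n))//.
  by near: n; exact: nbhs_infty_ger.
exists c => // v hv.
have [b bv] := orbit_dense w' v hw' hv.
have L := mass_cvg hC3 A _ _ (fun n => hull_translate (b n) w' hw') hv bv.
have L' : mass A (translate (b n) w') @[n --> \oo] --> c.
  by under eq_fun do rewrite mw'; exact: cvg_cst.
exact: (cvg_unique _ L L').
Unshelve. all: by end_near. Qed.

Lemma leak_eq0 w : hull S w -> leak A w = 0.
Proof.
move=> hw; have [c _ hc] := mass_constant.
have := is_derive_mass hC3 A no_inflow w 0 hw.
rewrite (_ : (fun _ => _) = cst c); last first.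
  by apply/funext => t; apply: hc; exact: hull_translate.
by move=> [_]; rewrite derive_cst translate0 => /esym/eqP;
  rewrite oppr_eq0 => /eqP.
Qed.

Lemma leak_out_eq0 w i : hull S w -> A i -> q w ord0 i 0 = 0.
Proof.
move=> hw Ai; have /eqP := leak_eq0 w hw.
rewrite psumr_eq0 => [/allP/(_ i (mem_index_enum _))|j _]; last first.
  by rewrite addr_ge0 ?flow_ge0 ?sumr_ge0// => k _; rewrite flow_ge0.
by rewrite Ai /= paddr_eq0 ?flow_ge0 ?sumr_ge0// => [/andP[/eqP]|k _];
  rewrite ?flow_ge0.
Qed.

Lemma leak_across_eq0 w i j : hull S w -> A i -> ~~ A j ->
  q w (lift ord0 j) i 0 = 0.
Proof.
move=> hw Ai nAj; have /eqP := leak_eq0 w hw.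
rewrite psumr_eq0 => [/allP/(_ i (mem_index_enum _))|k _]; last first.
  by rewrite addr_ge0 ?flow_ge0 ?sumr_ge0// => l _; rewrite flow_ge0.
rewrite Ai /= paddr_eq0 ?flow_ge0 ?sumr_ge0// => [/andP[_]|k _];
  last by rewrite flow_ge0.
rewrite psumr_eq0 => [/allP/(_ j (mem_index_enum _))|k _];
  last by rewrite flow_ge0.
by rewrite nAj => /eqP.
Qed.

End MassConstant.

(** * Propagation of emptiness through the pipes *)

Lemma flow_eq0_present k j : carries S k j ->
  (forall w, hull S w -> q w k j 0 = 0) -> forall w, hull S w -> f w j = 0.
Proof.
move=> ckj q0 w hw; apply/eqP; case: eqVneq => // fw0.
have fw : 0 < f w j by rewrite lt_neqAle eq_sym fw0 present_ge0.
have [d d0 hd] := hull_carries S _ _ _ ckj fw.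
have := hd w 0 hw; have := q0 w hw.
by rewrite /flow translate0 => ->; rewrite leNgt d0.
Qed.

Lemma no_pipe_flow k j w t : (forall t v, 0 <= v -> pipe S k j t v = 0) ->
  hull S w -> q w k j t = 0.
Proof.
move=> h hw; apply: (hull_no_pipe S) => //; apply: present_ge0.
exact: hull_translate.
Qed.

(** When x_i vanishes, [Dop] is minus a sum of nonnegative integrals, yet it is nonnegative on [K].
    It is therefore 0 along orbits, and its derivative, a sum of nonnegative arrivals, is 0 too. *)
Lemma present_eq0_inflow i : (forall w, hull S w -> f w i = 0) ->
  forall w j, hull S w -> \int[mu S i j]_(s in past R) q w (lift ord0 i) j s =
    0.
Proof.
move=> f0.
have D0 w : hull S w -> Dop S i (x w) = 0.
  move=> hw; apply/eqP; rewrite eq_le graph_D_ge0// andbT graph_D// f0// sub0r.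
  rewrite oppr_le0; apply: sumr_ge0 => j _; apply: Rintegral_ge0 => s _.
  by apply: present_ge0; exact: hull_translate.
move=> w j hw.
have : vector_field S i w (x w) = 0.
  have := is_derive_D w i 0 hw; rewrite (_ : (fun _ => _) = cst 0); last first.
    by apply/funext => t; apply: D0; exact: hull_translate.
  by move=> [_]; rewrite derive_cst translate0.
have q0 k : q w k i 0 = 0 by rewrite /flow translate0 f0// (hull_wpipe0 S).
rewrite graph_vector_field// q0 oppr0 add0r big1 ?oppr0 ?add0r// => /eqP.
rewrite psumr_eq0 => [/allP/(_ j (mem_index_enum _))/eqP//|l _].
by apply: Rintegral_ge0 => s _; exact: flow_ge0.
Qed.

(** If C_j were nonempty at w, its flow to C_i would stay above some e > 0 on a time window.
    Arrivals at C_i vanish over every translate of w, so every shift of this window is mu-null.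
    Countably many shifts cover the past, which has mass 1. *)
Lemma present_eq0_backward (hC3 : condC3 S) i j : carries S (lift ord0 i) j ->
  (forall w, hull S w -> f w i = 0) -> forall w, hull S w -> f w j = 0.
Proof.
move=> cij f0 w hw; apply/eqP; case: eqVneq => // fw0.
have fw : 0 < f w j by rewrite lt_neqAle eq_sym fw0 present_ge0.
have fw2 : 0 < f w j / 2 by rewrite divr_gt0.
have [e e0 he] := hull_carries S _ _ _ cij fw2.
(* By continuity the present value stays above half of [f w j] on the window; monotonicity then
   keeps the flow above e, the rate guaranteed at that half. *)
have [d d0 hd] : exists2 d : R, 0 < d &
    forall t, `|t| < d -> e <= q w (lift ord0 i) j t.
  have /cvgrPdist_lt/(_ _ fw2)/nbhs_ballP[d /= d0 h] :=
    present_orbit_continuous w j hw 0.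
  exists d => // t td; have := h t; rewrite /ball /= sub0r normrN => /(_ td).
  rewrite translate0 ltr_norml => /andP[_ ft].
  apply: le_trans (he w t hw) _; apply: (hull_wpipe_homo S) => //; lra.
(* Seen from [translate a w], the window around time 0 of w is centred at -a. *)
pose I a : set R := `]- a - d, - a + d[%classic.
have mI a : measurable (I a : set (measurableTypeR R)) by exact: measurable_itv.
have mp := @measurable_past R.
have muI a : mu S i j (past R `&` I a) = 0%E.
  have mpI : measurable (past R `&` I a : set (measurableTypeR R))
    by exact: measurableI.
  have [B qB] := flow_bounded.
  have ha := hull_translate a w hw.
  have : \int[mu S i j]_(s in past R) (cst e \_ (I a)) s <=
      \int[mu S i j]_(s in past R) q (translate a w) (lift ord0 i) j s.
    apply: le_Rintegral => //.
    - apply: (@integrable_past_bounded _ _ _ e) => //.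
        apply/(measurable_restrict _ (mI a) mp); exact: measurable_cst.
      move=> s _; rewrite patchE; case: ifP => _; first by rewrite gtr0_norm.
      by rewrite normr0 ltW.
    - apply: (@integrable_past_continuous _ _ _ B);
      first exact: flow_continuous.
      by move=> s; exact: qB.
    - move=> s ps; rewrite patchE; case: ifP => [|_]; last exact: flow_ge0.
      rewrite inE /I /= in_itv /= flow_translate => /andP[? ?].
      by apply: hd; rewrite ltr_norml; apply/andP; split; lra.
  rewrite -Rintegral_mkcondr present_eq0_inflow// Rintegral_cst//.
  rewrite pmulr_rle0// => h.
  rewrite -[LHS]fineK ?fin_num_measure//; congr (_%:E).
  by apply/eqP; rewrite eq_le h fine_ge0.
have cover : past R `<=` \bigcup_n (past R `&` I (n%:R * d)).
  (* The centres are d apart and the half-width is d: with n the integer part of -s/d, s lies in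
     ]-(n+1)d, -nd]. *)
  move=> s ps; exists (Num.truncn (- s / d)) => //; split => //.
  move: ps; rewrite /past /I /= !in_itv /= => s0.
  have /truncn_itv : 0 <= - s / d by rewrite divr_ge0 ?oppr_ge0// ltW.
  rewrite ler_pdivlMr// ltr_pdivrMr// -natr1 mulrDl mul1r => /andP[? ?].
  by apply/andP; split; lra.
have := measure_sigma_subadditive (mu S i j) _ mp cover.
rewrite eseries0 => [|n _ _]; last exact: muI.
move=> /(_ (fun n => measurableI _ _ mp (mI _))).
have [mu1 _] := hC3 i j.
by rewrite [leLHS](_ : _ = 1%E) ?lee_fin ?ler10//; exact: mu1.
Qed.

Lemma vanishes_present i : vanishes S x i <-> forall w, hull S w -> f w i = 0.
Proof.
split=> [h w hw|h w hw s s0]; first exact: h.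
by rewrite graph_history//; apply: h; exact: hull_translate.
Qed.

Lemma irreducible_subset (J : set 'I_m) : J !=set0 -> zeta S J `<=` J ->
  exists2 J', irreducible_set S J' & J' `<=` J.
Proof.
have [n] := ubnP #|[pred i | `[< J i >]]|.
elim: n => // n IH in J *; rewrite ltnS => cJ J0 zJ.
have [irr|nirr] := pselect (irreducible_set S J); first by exists J.
have [J' [J'0 J'J zJ']] : exists J', [/\ J' !=set0, J' `<` J & zeta
  S J' `<=` J'].
  apply: contrapT => h; apply: nirr; split => // J' J'0 J'J zJ'.
  by apply: h; exists J'.
have [|||J'' irr J''J'] := IH J' => //.
  apply: leq_trans cJ; apply: proper_card; apply/fintype.properP.
  have [sJ [i Ji nJ'i]] : J' `<=` J /\ exists2 i, J i & ~ J' i.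
    case: J'J => sJ /nonsubset [i [? ?]]; split => //; exists i => //.
  split; first by apply/fintype.subsetP => k; rewrite !inE; exact: sJ.
  by exists i; [rewrite inE|apply/negP; rewrite inE].
by exists J'' => //; apply: subset_trans J''J' _; case: J'J.
Qed.

Lemma total_mass_constant (hC3 : condC3 S) :
  exists2 c : R, 0 <= c & forall w y, K (w, y) -> total_mass S w y = c.
Proof.
have [//|c c0 hc] := mass_constant hC3 predT.
exists c => // w y /graph_memE[hw ->]; rewrite -(hc w hw); congr (_ + _).
apply: eq_bigr => i _; apply: eq_bigr => j _; apply: eq_Rintegral => s _.
apply: eq_Rintegral => r; rewrite inE /= in_itv /= => /andP[_ r0].
by rewrite graph_flow// /past /= in_itv.
Qed.

(** Irreducible sets are closed under [zeta], so no pipe carries material from them into J_0, and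
    the leak of J_0 is 0. A nonempty compartment of J_0 then feeds only nonempty compartments of
    J_0; these would contain an irreducible set, which J_0 excludes. *)
Lemma vanishes_transient (hC3 : condC3 S) (hC6 : condC6 S) i :
  (~` \bigcup_(J in irreducible_set S) J) i -> vanishes S x i.
Proof.
set J0 := ~` _ => J0i; apply/vanishes_present; apply: contrapT => nvi.
pose A : pred 'I_m := fun j => `[< J0 j >].
have noin j k : A j -> ~~ A k -> forall w t, hull S w ->
  q w (lift ord0 j) k t = 0.
  move=> /asboolP J0j /asboolP nJ0k w t hw.
  have [h|cjk] := hC6 (lift ord0 j) k; first exact: no_pipe_flow.
  exfalso; apply: nJ0k => -[J irrJ Jk]; apply: J0j; exists J => //.
  by have [_ zJ _] := irrJ; apply: zJ; exists k.
pose Z := [set j | J0 j /\ ~ forall w, hull S w -> f w j = 0].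
have zZ : zeta S Z `<=` Z.
  move=> j [k [J0k nvk] ckj]; split.
    apply: contrapT => nJ0j; apply: nvk; apply: flow_eq0_present ckj _ => w hw.
    by apply: (leak_across_eq0 hC3 A noin) => //; apply/asboolP.
  by move=> vj; apply: nvk; exact: present_eq0_backward ckj vj.
have [|J irrJ JZ] := irreducible_subset Z _ zZ; first by exists i.
have [[j Jj] _ _] := irrJ.
by have [+ _] := JZ j Jj; apply; exists J.
Qed.

Lemma vanishes_irreducible (hC3 : condC3 S) J : irreducible_set S J ->
  (exists2 j, J j & vanishes S x j) -> forall i, J i -> vanishes S x i.
Proof.
move=> [_ zJ minJ] [j Jj /vanishes_present vj] i Ji; apply/vanishes_present.
apply: contrapT => nvi.
(* [Z] misses j, so it is a proper subset of J; closed under [zeta], it contradicts the minimality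
   of J once it contains i. *)
pose Z := [set j | J j /\ ~ forall w, hull S w -> f w j = 0].
apply: (minJ Z); first by exists i.
- by split; [move=> k []|move=> /(_ j Jj)[]].
- move=> k [l [Jl nvl] ckl]; split; first by apply: zJ; exists l.
  by move=> vk; apply: nvl; exact: present_eq0_backward ckl vk.
Qed.

Lemma vanishes_outflow (hC3 : condC3 S) j : outflow S j -> vanishes S x j.
Proof.
move=> oj; apply/vanishes_present; apply: flow_eq0_present oj _ => w hw.
exact: (leak_out_eq0 hC3 predT).
Qed.

End MinimalGraph.

Theorem theorem6p3 (R : realType) (m : nat) (S : compartmental_system R m)
  (hC1 : condC1 S) (hC2 : condC2 S) (hC3 : condC3 S)
  (hC4 : condC4 S) (hC5 : condC5 S) (hC6 : condC6 S)
  (hF : regular_field S)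
  (hI : forall i t, inflow S i t = 0)
  (K : set (transport R m * history R m))
  (x : transport R m -> history R m)
  (hKx : K = [set (w, x w) | w in hull S])
  (hKmin : minimal_set (positively_invariant S) K)
  (hKpos : K `<=` hull S `*` BUD_pos S) :
  [/\ (* (i) *)
      exists2 c : R, 0 <= c & forall w y, K (w, y) -> total_mass S w y = c,
      (* (ii) *)
      forall i, (~` \bigcup_(J in irreducible_set S) J) i -> vanishes S x i &
      (* (iii) *)
      forall J, irreducible_set S J ->
        ((exists2 j, J j & vanishes S x j) ->
           forall i, J i -> vanishes S x i) /\
        ((exists2 j, J j & outflow S j) ->
           forall i, J i -> vanishes S x i)].
Proof.
split.
- exact: (@total_mass_constant _ _ S hC1 hC2 hC4 hI K x).
- by move=> i; exact: (@vanishes_transient _ _ S hC1 hC2 hC4 hI K x).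
- move=> J irrJ.
  have vJ := @vanishes_irreducible _ _ S hC1 hC2 hC4 hI K x hKx hKmin
    hKpos hC3 J irrJ.
  split=> // -[j Jj oj]; apply: vJ; exists j => //.
  exact: (@vanishes_outflow _ _ S hC1 hC2 hC4 hI K x).
Qed.
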